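(* Let $\varphi\colon A\to\mathcal{B}(X)$ be a representation (bounded linear multiplicative map) of a Banach algebra $A$ on a Banach space $X$, and set $\tilde{\varphi}=\alpha_X\circ\varphi^{**}\colon A^{**}\to\mathcal{B}(X,X^{**})$. Then the image of $\tilde{\varphi}$ is contained in $\gamma_X(\mathcal{B}(X))$ if and only if for every $x\in X$ the orbit map $\mathrm{ev}_x\circ\varphi\colon A\to X$, $a\mapsto \varphi(a)x$, is weakly compact. Moreover, if this is the case, then, regarding $\tilde{\varphi}$ as a map $A^{**}\to\mathcal{B}(X)$: (1) the essential spaces of $\varphi$ and $\tilde{\varphi}$ agree; (2) $\tilde{\varphi}$ is multiplicative with respect to both the left and the right Arens product on $A^{**}$; (3) $\tilde{\varphi}\circ\kappa_A=\varphi$.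
   Context: For a Banach space $E$, $\kappa_E\colon E\to E^{**}$ is the canonical embedding. The left Arens product $\square$ and right Arens product $\diamond$ on $A^{**}$ are defined by $S\square T=\text{weak*-}\lim_i\text{weak*-}\lim_j\kappa_A(a_ib_j)$ and $S\diamond T=\text{weak*-}\lim_j\text{weak*-}\lim_i\kappa_A(a_ib_j)$ for bounded nets $(a_i),(b_j)$ in $A$ with $\kappa_A(a_i)\to S$, $\kappa_A(b_j)\to T$ weak*. $\mathcal{B}(X,X^{**})$ is a unital Banach algebra with product $ab=\kappa_{X^*}^*\circ a^{**}\circ b$. $\gamma_X\colon\mathcal{B}(X)\to\mathcal{B}(X,X^{**})$ is $\gamma_X(a)=\kappa_X\circ a$, an isometric multiplicative map, through which $\mathcal{B}(X)$ is regarded as a subalgebra of $\mathcal{B}(X,X^{**})$. For $x\in X$, $\mathrm{ev}_x\colon\mathcal{B}(X)\to X$ is $\mathrm{ev}_x(a)=a(x)$, and $\alpha_X\colon\mathcal{B}(X)^{**}\to\mathcal{B}(X,X^{**})$ is defined by $\alpha_X(S)(x)=\mathrm{ev}_x^{**}(S)$. The essential space of a representation $\psi$ of an algebra $B$ on $X$ is the closed linear span $X_\psi$ of $\{\psi(b)x: b\in B, x\in X\}$. *)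

(* Defs.v *)
From HB Require Import structures.
From mathcomp Require Import all_boot all_order all_algebra.
From mathcomp Require Import all_classical all_reals all_analysis.
From mathcomp Require Export complex.
Import numFieldNormedType.Exports.

Set Implicit Arguments.
Unset Strict Implicit.
Unset Printing Implicit Defensive.

Import Order.TTheory GRing.Theory Num.Theory.
Local Open Scope classical_set_scope.
Local Open Scope ring_scope.

Section BanachDefs.
Variable K : numFieldType.

Definition bdd_linear (V W : normedModType K) (T : V -> W) : Prop :=
  (forall (c : K) (u v : V), T (c *: u + v) = c *: T u + T v) /\
  (exists M : K, forall v : V, `|T v| <= M * `|v|).

Definition is_dual (V : normedModType K) (f : V -> K) : Prop :=
  (forall (c : K) (u v : V), f (c *: u + v) = c * f u + f v) /\
  (exists M : K, forall v : V, `|f v| <= M * `|v|).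

Definition dualT (V : normedModType K) : Type := {f : V -> K | is_dual f}.

(** Elements of the bidual V'' : bounded linear functionals on V'.
    They are represented as functions (V -> K) -> K, and only their values on
    elements of V' are relevant.  Boundedness : |F f| <= M * c whenever c
    bounds the norm of f. *)
Definition is_bidual (V : normedModType K) (F : (V -> K) -> K) : Prop :=
  (forall (c : K) (f g : V -> K), is_dual f -> is_dual g ->
     F (fun v => c * f v + g v) = c * F f + F g) /\
  (exists M : K, forall (f : V -> K) (c : K), is_dual f ->
     0 <= c -> (forall v, `|f v| <= c * `|v|) -> `|F f| <= M * c).

Definition kappa (V : normedModType K) (v : V) : (V -> K) -> K := fun f => f v.

Definition weak_of (V : normedModType K) :=
  initial_topology
    ((fun v : V => (fun f : dualT V => proj1_sig f v)) : V -> {ptws dualT V -> K}).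

Definition cball1 (V : normedModType K) : set V := [set v | `|v| <= 1].

Definition weakly_compact (V W : normedModType K) (T : V -> W) : Prop :=
  @compact (weak_of W) (@closure (weak_of W) (T @` (@cball1 V))).

Definition lin_subspace (V : normedModType K) (M : set V) : Prop :=
  M 0 /\ forall (c : K) (u v : V), M u -> M v -> M (c *: u + v).

Definition closed_span (V : normedModType K) (S : set V) : set V :=
  \bigcap_(M in [set M : set V | [/\ closed M, lin_subspace M & S `<=` M]]) M.

Definition essential_space (B : Type) (Bdom : set B) (V : normedModType K)
  (rho : B -> V -> V) : set V :=
  closed_span [set rho b x | b in Bdom & x in [set: V]].

Definition banach_algebra_mul (A : normedModType K) (mul : A -> A -> A) : Prop :=
  [/\ (forall a b c, mul a (mul b c) = mul (mul a b) c),
      (forall (k : K) (a b c : A), mul (k *: a + b) c = k *: mul a c + mul b c),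
      (forall (k : K) (a b c : A), mul a (k *: b + c) = k *: mul a b + mul a c)
    & (forall a b, `|mul a b| <= `|a| * `|b|)].

Definition representation (A X : normedModType K) (mul : A -> A -> A)
  (phi : A -> X -> X) : Prop :=
  [/\ (forall a, bdd_linear (phi a)),
      (forall (c : K) (a b : A) (x : X), phi (c *: a + b) x = c *: phi a x + phi b x),
      (exists M : K, forall a x, `|phi a x| <= M * `|a| * `|x|)
    & (forall a b x, phi (mul a b) x = phi a (phi b x))].

(** phitilde = alpha_X o phi'' : A'' -> B(X, X''), unfolded:
    phitilde S x = ev_x''(phi'' S), i.e. (phitilde S x) f = S (f o ev_x o phi). *)
Definition phitilde (A X : normedModType K) (phi : A -> X -> X)
  (S : (A -> K) -> K) (x : X) : (X -> K) -> K :=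
  fun f => S (fun a => f (phi a x)).

(** Arens products on A'' (iterated weak*-limits, evaluated):
    (S [] T) f = S (a |-> T (b |-> f (a b)))
    (S <> T) f = T (b |-> S (a |-> f (a b))) *)
Definition arens_left (A : normedModType K) (mul : A -> A -> A)
  (S T : (A -> K) -> K) : (A -> K) -> K :=
  fun f => S (fun a => T (fun b => f (mul a b))).

Definition arens_right (A : normedModType K) (mul : A -> A -> A)
  (S T : (A -> K) -> K) : (A -> K) -> K :=
  fun f => T (fun b => S (fun a => f (mul a b))).

End BanachDefs.

(* Main.v *)
(** By Hahn-Banach, X embeds isometrically into X'', so every phitilde S is an
    operator on X exactly when the second adjoint of each orbit map
    a |-> phi a x maps A'' into X.  This is Gantmacher's criterion for weak
    compactness of the orbit map: if the weak closure of the image of the ball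
    is compact, then it is closed in the topology of pointwise convergence on
    X', and Goldstine's theorem puts the second adjoint of the ball inside it;
    conversely the ball of A'' is compact (Banach-Alaoglu), hence so is its
    image in X with the weak topology.  Once phitilde is X-valued, the
    remaining claims are obtained by testing against X': evaluating the
    iterated functionals S and T gives multiplicativity, and a functional
    vanishing on the essential space of phi vanishes on every phitilde S x.

    Hahn-Banach is proved from the fact that a minimal sublinear functional is
    linear, and Goldstine's theorem from a nearly minimising point of a
    quadratic distance. *)
Require Import Defs.
From HB Require Import structures.
From mathcomp Require Import all_boot all_order all_algebra.
From mathcomp Require Import all_classical all_reals all_analysis.
From mathcomp Require Import complex.
From mathcomp Require Import ring lra.
Import numFieldNormedType.Exports.
Import Order.TTheory GRing.Theory Num.Theory.
Local Open Scope classical_set_scope.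
Local Open Scope ring_scope.
Local Open Scope complex_scope.

Local Notation Re := complex.Re.
Local Notation Im := complex.Im.

(** * Hahn-Banach theorem *)

Section SublinearFunctionals.
Context {R : realType} {V : lmodType R}.
Implicit Types (p q : V -> R) (u v x : V).

Definition sublinear q : Prop :=
  (forall u v, q (u + v) <= q u + q v) /\
  (forall (r : R) v, 0 <= r -> q (r *: v) <= r * q v).

Lemma sublinear0 q : sublinear q -> q 0 = 0.
Proof.
move=> [qD qZ]; have := qD 0 0; have := qZ 0 0 (lexx _).
by rewrite addr0 scale0r mul0r; lra.
Qed.

Lemma sublinear_homo q (r : R) v : sublinear q -> 0 <= r ->
  q (r *: v) = r * q v.
Proof.
move=> sq; have [_ qZ] := sq; rewrite le_eqVlt => /orP[/eqP<-|r0].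
  by rewrite scale0r mul0r sublinear0.
apply/le_anti/andP; split; first exact: (qZ _ _ (ltW r0)).
rewrite -ler_pdivlMl//.
have := qZ r^-1 (r *: v); rewrite invr_ge0 (ltW r0) => /(_ isT).
by rewrite scalerA mulVf ?gt_eqF// scale1r.
Qed.

Lemma sublinear_opp q v : sublinear q -> - q (- v) <= q v.
Proof.
by move=> sq; have := sq.1 v (- v); rewrite subrr sublinear0//; lra.
Qed.

(* The functional [v |-> inf_(t >= 0) (q (v + t x) - t q x)] is the largest
   sublinear minorant of [q] that takes the value [- q x] at [- x]. *)
Lemma sublinear_tilt q x : sublinear q ->
  exists q', [/\ sublinear q', forall v, q' v <= q v & q' (- x) <= - q x].
Proof.
move=> sq; have [qD qZ] := sq.
pose E v : set R := [set q (v + t *: x) - t * q x | t in [set t | 0 <= t]].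
have E0 v : E v !=set0 by exists (q (v + 0 *: x) - 0 * q x), 0 => //=.
have lbE v : lbound (E v) (- q (- v)).
  move=> _ [t /= t0 <-]; have := qD (v + t *: x) (- v).
  by rewrite addrAC subrr add0r sublinear_homo//; lra.
have infE v t : 0 <= t -> inf (E v) <= q (v + t *: x) - t * q x.
  by move=> t0; apply: ge_inf; [exists (- q (- v))|exists t].
exists (fun v => inf (E v)); split.
- split=> [u v|r v].
    rewrite -lerBlDr; apply: lb_le_inf => // _ [s /= s0 <-].
    rewrite lerBlDr -lerBlDl; apply: lb_le_inf => // _ [t /= t0 <-].
    rewrite lerBlDl; apply: le_trans (infE _ (s + t) (addr_ge0 s0 t0)) _.
    have := qD (u + s *: x) (v + t *: x).
    by rewrite addrACA -scalerDl mulrDl; lra.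
  rewrite le_eqVlt => /orP[/eqP<-|r0].
    have := infE 0 0 (lexx _); rewrite scale0r.
    by rewrite scale0r addr0 sublinear0// !mul0r subr0.
  rewrite -ler_pdivrMl//; apply: lb_le_inf => // _ [t /= t0 <-].
  rewrite ler_pdivrMl//.
  apply: le_trans (infE _ (r * t) (mulr_ge0 (ltW r0) t0)) _.
  by rewrite -scalerA -scalerDr sublinear_homo ?(ltW r0)// mulrBr mulrA.
- by move=> v; have := infE v 0 (lexx _); rewrite scale0r addr0 mul0r subr0.
- by have := infE (- x) 1 ler01; rewrite scale1r addNr sublinear0// mul1r sub0r.
Qed.

(** The infimum is finite because [q v >= - q (- v) >= - p (- v)] for every member. Subadditivity
    needs the chain condition: of two members, the smaller one estimates both summands at once. *)
Lemma sublinear_inf (p : V -> R) (C : set (V -> R)) :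
  C !=set0 -> (forall q, C q -> sublinear q /\ forall v, q v <= p v) ->
  (forall q1 q2, C q1 -> C q2 ->
    (forall v, q1 v <= q2 v) \/ (forall v, q2 v <= q1 v)) ->
  exists q, sublinear q /\ forall q', C q' -> forall v, q v <= q' v.
Proof.
move=> [q0 Cq0] Cp Ctot; pose E v : set R := [set q v | q in C].
have E0 v : E v !=set0 by exists (q0 v), q0.
have infE v q : C q -> inf (E v) <= q v.
  move=> Cq; apply: ge_inf; last by exists q.
  exists (- p (- v)) => _ [q' Cq' <-]; have [sq' q'p] := Cp _ Cq'.
  by apply: le_trans (sublinear_opp _ v sq'); rewrite lerN2.
exists (fun v => inf (E v)); split; last by move=> q' Cq' v; exact: infE.
split=> [u v|r v].
  rewrite -lerBlDr; apply: lb_le_inf => // _ [q1 Cq1 <-].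
  rewrite lerBlDr -lerBlDl; apply: lb_le_inf => // _ [q2 Cq2 <-].
  rewrite lerBlDl.
  have [le12|le21] := Ctot _ _ Cq1 Cq2.
    apply: le_trans (infE _ _ Cq1) _; have [[qD _] _] := Cp _ Cq1.
    by have := qD u v; have := le12 v; lra.
  apply: le_trans (infE _ _ Cq2) _; have [[qD _] _] := Cp _ Cq2.
  by have := qD u v; have := le21 u; lra.
rewrite le_eqVlt => /orP[/eqP<-|r0].
  by rewrite scale0r mul0r -(sublinear0 _ (Cp _ Cq0).1); exact: infE.
rewrite -ler_pdivrMl//; apply: lb_le_inf => // _ [q Cq <-].
rewrite ler_pdivrMl// -sublinear_homo ?(ltW r0)//; first exact: infE.
exact: (Cp _ Cq).1.
Qed.

(** Zorn's lemma for the reversed pointwise order on the sublinear functionals below [p]. A nonempty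
    chain is bounded by its infimum, the empty one by [p] itself. *)
Lemma minimal_sublinear p : sublinear p ->
  exists q, [/\ sublinear q, forall v, q v <= p v &
    forall q', sublinear q' -> (forall v, q' v <= q v) -> q' = q].
Proof.
move=> sp; pose T := {q | sublinear q /\ forall v, q v <= p v}.
pose below (s t : T) := `[< forall v, sval t v <= sval s v >].
have [||||[q [sq qp]] qmin] := @Zorn T below.
- by move=> t; apply/asboolP.
- move=> r s t /asboolP rs /asboolP st; apply/asboolP => v.
  exact: le_trans (st v) (rs v).
- move=> [s hs] [t ht] /asboolP /= st /asboolP /= ts.
  have e : s = t by apply/funext => v; apply/le_anti; rewrite st ts.
  by subst t; congr exist; exact: Prop_irrelevance.
- move=> C Ctot; have [[s0 Cs0]|C0] := pselect (C !=set0); last first.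
    exists (exist _ p (conj sp (fun v => lexx _))) => s Cs.
    by exfalso; apply: C0; exists s.
  have [|||q [sq qC]] := @sublinear_inf p [set sval s | s in C].
  + by exists (sval s0), s0.
  + by move=> _ [s _ <-]; exact: (svalP s).
  + move=> _ _ [s Cs <-] [t Ct <-].
    by have [/asboolP|/asboolP] := Ctot _ _ Cs Ct; [right|left].
  have qp v : q v <= p v.
    by apply: le_trans ((svalP s0).2 v); apply: qC; exists s0.
  exists (exist _ q (conj sq qp)) => s Cs; apply/asboolP => v /=.
  by apply: qC; exists s.
exists q; split => // q' sq' q'q.
have q'p v : q' v <= p v by exact: le_trans (q'q v) (qp v).
by have /(congr1 sval) := qmin (exist _ q' (conj sq' q'p)) (asboolT q'q).
Qed.

(** Tilting [p] at [x] before minimising forces [f (- x) <= - p x], hence [f x = p x]. A tilt of the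
    minimal [f] at any [u] is [f] again, so [f] is odd, and an odd sublinear functional is
    linear. *)
Theorem hahn_banach_sublinear p x : sublinear p ->
  exists f : V -> R,
    [/\ forall (r : R) u v, f (r *: u + v) = r * f u + f v,
        forall v, f v <= p v & f x = p x].
Proof.
move=> sp; have [p' [sp' p'p p'x]] := sublinear_tilt _ x sp.
have [f [sf fp' fmin]] := minimal_sublinear _ sp'.
have fN u : f (- u) = - f u.
  have [f' [sf' f'f f'u]] := sublinear_tilt _ u sf.
  apply/le_anti; rewrite -{1}(fmin f') ?f'u//=.
  by have := sublinear_opp _ u sf; lra.
have fD u v : f (u + v) = f u + f v.
  apply/le_anti; rewrite sf.1 /=.
  by have := sf.1 (u + v) (- v); rewrite addrK fN; lra.
exists f; split=> [r u v|v|].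
- rewrite fD; congr (_ + _).
  have [r0|r0] := leP 0 r; first exact: sublinear_homo.
  rewrite -[r]opprK scaleNr fN sublinear_homo ?mulNr//.
  by rewrite oppr_ge0 ltW.
- exact: le_trans (fp' v) (p'p v).
- apply/le_anti; rewrite (le_trans (fp' x) (p'p x))/=.
  by have := le_trans (fp' (- x)) p'x; rewrite fN lerN2.
Qed.

End SublinearFunctionals.

(** * Order, modulus and rotation of complex numbers *)

Section ComplexNumbers.
Context {R : realType}.

Lemma Re_ge0K (z : R[i]) : 0 <= z -> (Re z)%:C = z.
Proof. by move=> z0; rewrite RRe_real ?ger0_real. Qed.

Lemma ReD (z w : R[i]) : Re (z + w) = Re z + Re w.
Proof. by case: z w => ? ? []. Qed.

Lemma ReM_ge0 (z w : R[i]) : 0 <= z -> 0 <= w -> Re (z * w) = Re z * Re w.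
Proof.
move=> /ger0_Im z0 /ger0_Im w0; move: z w z0 w0 => [a b] [c d] /= -> ->.
by rewrite mulr0 subr0.
Qed.

Lemma Re_le (z w : R[i]) : z <= w -> Re z <= Re w.
Proof. by rewrite lecE => /andP[]. Qed.

Lemma Re_le_norm (z : R[i]) : Re z <= Re `|z|.
Proof.
by apply: le_trans (ler_norm _) _; have /Re_le := normc_ge_Re z.
Qed.

Lemma exists_rotation (z : R[i]) : exists2 u : R[i], `|u| = 1 & u * z = `|z|.
Proof.
have [->|z0] := eqVneq z 0; first by exists 1; rewrite ?normr1// mulr0 normr0.
exists (`|z| / z); last by rewrite divfK.
by rewrite normf_div normr_id divff// normr_eq0.
Qed.

End ComplexNumbers.

(** The alias carries a module structure over [R], kept apart from the one over [R[i]] on the same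
    vectors. *)
Definition realification {R : realType} (V : lmodType R[i]) : Type := V.

(** * From the real to the complex Hahn-Banach theorem *)

Section ComplexHahnBanach.
Context {R : realType}.

Section Realification.
Variable V : lmodType R[i].

HB.instance Definition _ := GRing.Zmodule.on (realification V).

Let scale (r : R) (v : realification V) : realification V := r%:C *: (v : V).

Let scaleA r s v : scale r (scale s v) = scale (r * s) v.
Proof. by rewrite /scale scalerA rmorphM. Qed.

Let scale1 : left_id 1 scale.
Proof. by move=> v; rewrite /scale scale1r. Qed.

Let scaleDr : right_distributive scale +%R.
Proof. by move=> r u v; rewrite /scale scalerDr. Qed.

Let scaleDl v : {morph scale^~ v : r s / r + s}.
Proof. by move=> r s; rewrite /scale rmorphD scalerDl. Qed.

HB.instance Definition _ := GRing.Zmodule_isLmodule.Build R (realification V)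
  scaleA scale1 scaleDr scaleDl.

End Realification.

(* A real functional [f] dominated by [p] is the real part of the complex
   functional [v |-> f v - i f (i v)]; rotating [v] bounds its modulus. *)
Theorem hahn_banach_seminorm (V : lmodType R[i]) (p : V -> R) (x : V) :
  (forall u v, p (u + v) <= p u + p v) ->
  (forall (c : R[i]) v, p (c *: v) = Re `|c| * p v) ->
  exists g : V -> R[i],
    [/\ forall (c : R[i]) u v, g (c *: u + v) = c * g u + g v,
        forall v, `|g v| <= (p v)%:C & (p x)%:C <= `|g x|].
Proof.
move=> pD pZ.
have [] := @hahn_banach_sublinear R (realification V) p x.
  split=> [|r v r0]; first exact: pD.
  by rewrite [r *: v]/(r%:C *: (v : V)) pZ ger0_norm ?ler0c.
move=> f [flin fp fx].
have fE (r : R) (u v : V) : f (r%:C *: u + v : V) = r * f u + f v.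
  exact: (flin r u v).
pose g v : R[i] := f v +i* (- f ('i *: v : V)).
have fC (a b : R) (u v : V) : f ((a +i* b) *: u + v : V) =
    a * f u + b * f ('i *: u : V) + f v.
  rewrite -addrA -!fE addrA scalerA -scalerDl [a +i* b]complexE /=.
  by rewrite ['i * _]mulrC.
have glin (c : R[i]) u v : g (c *: u + v) = c * g u + g v.
  case: c => a b; rewrite /g fC.
  have -> : 'i *: ((a +i* b) *: u + v) = (- b +i* a) *: u + 'i *: v :> V.
    rewrite scalerDr scalerA; congr (_ *: _ + _).
    by apply/eqP; rewrite eq_complex /= !mul0r !mul1r sub0r add0r !eqxx.
  rewrite fC; apply/eqP; rewrite eq_complex /=; apply/andP.
  by split; apply/eqP; ring.
have gZ (c : R[i]) v : g (c *: v) = c * g v.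
  have g0 : g 0 = 0.
    have := glin 1 0 0; rewrite scale1r addr0 mul1r => /eqP.
    by rewrite -subr_eq subrr eq_sym => /eqP.
  by have := glin c v 0; rewrite g0 !addr0.
exists g; split=> // [v|].
  have [u u1 ug] := exists_rotation (g v).
  rewrite -ug -gZ -[g _]Re_ge0K; last by rewrite gZ ug.
  rewrite lecR; apply: le_trans (fp (u *: v : V)) _.
  by rewrite pZ u1 mul1r.
rewrite -[ `|g x|]Re_ge0K// lecR -fx.
exact: (Re_le_norm (g x)).
Qed.

End ComplexHahnBanach.

(** * Dual spaces *)

Section DualSpace.
Context {R : realType}.

(** The constant in a boundedness hypothesis can be an arbitrary complex number, for instance on the
    zero space. This replaces it by its modulus: [0 <= r <= c * s] makes [c * s] real. *)
Lemma le_normM_abs (c r s : R[i]) : 0 <= s -> r <= c * s -> 0 <= r ->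
  r <= `|c| * s.
Proof.
move=> s0 rcs r0; apply: (le_trans rcs).
rewrite -{2}(ger0_norm s0) -normrM real_ler_norm// ger0_real//.
exact: le_trans r0 rcs.
Qed.

(** The seminorm is the distance to [N]. A functional dominated by it is bounded and vanishes on
    [N], which is what separation requires. *)
Lemma dist_seminorm (V : normedModType R[i]) (N : set V) : lin_subspace N ->
  exists p : V -> R,
    [/\ forall u v, p (u + v) <= p u + p v,
        forall (c : R[i]) v, p (c *: v) = Re `|c| * p v,
        forall v n, N n -> p v <= Re `|v - n| &
        forall v d, (forall n, N n -> d <= Re `|v - n|) -> d <= p v].
Proof.
move=> [N0 Nlin]; pose E v : set R := [set Re `|v - n| | n in N].
have ND u v : N u -> N v -> N (u + v).
  by move=> Nu Nv; rewrite -[u]scale1r; exact: Nlin.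
have NZ (c : R[i]) v : N v -> N (c *: v).
  by move=> Nv; rewrite -[_ *: _]addr0; exact: Nlin.
have E0 v : E v !=set0 by exists (Re `|v - 0|), 0.
have ge0 (z : V) : 0 <= Re `|z| by rewrite (Re_le _ _ (normr_ge0 z)).
have infE v n : N n -> inf (E v) <= Re `|v - n|.
  by move=> Nn; apply: ge_inf; [exists 0 => _ [m _ <-]|exists n].
have dZ (c : R[i]) v : c != 0 -> inf (E (c *: v)) <= Re `|c| * inf (E v).
  move=> c0; have Rc0 : 0 < Re `|c|.
    by rewrite -ltcR Re_ge0K ?normr_gt0.
  rewrite -ler_pdivrMl//; apply: lb_le_inf => // _ [n Nn <-].
  rewrite ler_pdivrMl//; apply: le_trans (infE _ (c *: n) (NZ _ _ Nn)) _.
  by rewrite -scalerBr normrZ ReM_ge0.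
exists (fun v => inf (E v)); split=> //.
- move=> u v; rewrite -lerBlDr; apply: lb_le_inf => // _ [n Nn <-].
  rewrite lerBlDr -lerBlDl; apply: lb_le_inf => // _ [m Nm <-].
  rewrite lerBlDl; apply: le_trans (infE _ _ (ND _ _ Nn Nm)) _.
  by rewrite -ReD opprD addrACA; apply/Re_le/ler_normD.
- move=> c v; have [->|c0] := eqVneq c 0.
    rewrite scale0r normr0 mul0r; apply/le_anti/andP; split.
      by have := infE 0 0 N0; rewrite subr0 normr0.
    by apply: lb_le_inf => // _ [n _ <-].
  apply/le_anti; rewrite dZ//=.
  (* The reverse inequality is [dZ] for the inverse scalar. *)
  have := dZ c^-1 (c *: v); rewrite invr_eq0 scalerA mulVf// scale1r => /(_ c0).
  have Rc0 : 0 < Re `|c| by rewrite -ltcR Re_ge0K ?normr_gt0.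
  have -> : Re `|c^-1| = (Re `|c|)^-1.
    apply: (mulIf (lt0r_neq0 Rc0)); rewrite mulVf ?gt_eqF//.
    by rewrite -ReM_ge0// -normrM mulVf// normr1.
  by rewrite ler_pdivlMl.
- by move=> v d Hd; apply: lb_le_inf => // _ [n Nn <-]; exact: Hd.
Qed.

Variable V : normedModType R[i].
Implicit Types (f : V -> R[i]) (u v : V).

Lemma is_dual_le f : is_dual f ->
  exists2 c : R[i], 0 <= c & forall v, `|f v| <= c * `|v|.
Proof.
by move=> [_ [M fM]]; exists `|M| => // v; exact: le_normM_abs.
Qed.

Lemma dual_norming (y : V) : exists f,
  [/\ is_dual f, forall v, `|f v| <= `|v| & `|y| <= `|f y|].
Proof.
have [|c v|f [flin fle fy]] := @hahn_banach_seminorm R V (fun v => Re `|v|) y.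
- by move=> u v; rewrite -ReD; apply/Re_le/ler_normD.
- by rewrite normrZ ReM_ge0.
exists f; split=> [|v|]; last by rewrite Re_ge0K in fy.
  by split=> //; exists 1 => v; have := fle v; rewrite Re_ge0K// mul1r.
by have := fle v; rewrite Re_ge0K.
Qed.

Lemma is_dualB f u v : is_dual f -> f (u - v) = f u - f v.
Proof. by move=> [flin _]; rewrite addrC -scaleN1r flin mulN1r addrC. Qed.

Lemma is_dual0 f : is_dual f -> f 0 = 0.
Proof.
by move=> fd; rewrite -[X in f X](subrr 0) (is_dualB _ _ _ fd) subrr.
Qed.

Lemma dual_separates u v : (forall f, is_dual f -> f u = f v) -> u = v.
Proof.
move=> fuv; have [f [fd _]] := dual_norming (u - v).
rewrite (is_dualB _ _ _ fd) (fuv _ fd) subrr normr0 normr_le0 subr_eq0.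
exact/eqP.
Qed.

(** For [x] outside [N], Hahn-Banach applied to the distance seminorm gives a functional that
    vanishes on [N] and whose modulus at [x] is at least the distance; closedness makes this
    distance positive. *)
Lemma dual_separates_closed_subspace (N : set V) (x : V) :
  closed N -> lin_subspace N ->
  (forall f, is_dual f -> (forall v, N v -> f v = 0) -> f x = 0) -> N x.
Proof.
move=> Nc Nlin fNx; apply: contrapT => Nx.
have [p [pD pZ ple pge]] := dist_seminorm V N Nlin.
have [f [flin fle fx]] := @hahn_banach_seminorm R V p x pD pZ.
have fd : is_dual f.
  split=> //; exists 1 => v; rewrite mul1r (le_trans (fle v))//.
  rewrite -[leRHS]Re_ge0K// lecR.
  by have := ple v 0 Nlin.1; rewrite subr0.
have fN v : N v -> f v = 0.
  move=> Nv; apply/eqP; rewrite -normr_le0 (le_trans (fle v))//.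
  by have := ple v v Nv; rewrite subrr normr0 -lecR.
have : nbhs x (~` N) by apply: open_nbhs_nbhs; split=> //; exact: closed_openC.
move=> /nbhs_ballP[e /= e0 eN].
have : Re e <= p x.
  apply: pge => n Nn; apply/Re_le; rewrite real_leNgt ?ger0_real// ?ltW//.
  apply/negP => xn; apply: eN Nn.
  by rewrite -ball_normE.
apply/negP; rewrite -ltNge -ltcR (le_lt_trans fx)// fNx// normr0.
by rewrite Re_ge0K// ltW.
Qed.

End DualSpace.

(** * Biduals and Goldstine's theorem *)

Section Bidual.
Context {R : realType} {V : normedModType R[i]}.
Implicit Types (f g : V -> R[i]) (u v : V) (S : (V -> R[i]) -> R[i]).

Lemma is_dual_cst0 : is_dual (fun _ : V => 0 : R[i]).
Proof.
split=> [c u v|]; first by rewrite mulr0 addr0.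
by exists 0 => v; rewrite normr0 mul0r.
Qed.

Lemma is_dual_lin (c : R[i]) f g : is_dual f -> is_dual g ->
  is_dual (fun v => c * f v + g v).
Proof.
move=> fd gd; have [a a0 fa] := is_dual_le _ _ fd.
have [b b0 gb] := is_dual_le _ _ gd; split=> [k u v|].
  by rewrite fd.1 gd.1; ring.
exists (`|c| * a + b) => v; rewrite (le_trans (ler_normD _ _))//.
by rewrite mulrDl lerD// normrM -mulrA ler_wpM2l.
Qed.

Lemma is_dual_sum (I : Type) (l : seq I) (c : I -> R[i]) (h : I -> V -> R[i]) :
  (forall i, is_dual (h i)) -> is_dual (fun v => \sum_(i <- l) c i * h i v).
Proof.
move=> hd; elim: l => [|i l IHl].
  under eq_fun do rewrite big_nil; exact: is_dual_cst0.
under eq_fun do rewrite big_cons; exact: is_dual_lin.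
Qed.

Lemma is_bidual0 S : is_bidual S -> S (fun=> 0) = 0.
Proof.
move=> [Slin _]; have := Slin (-1) _ _ is_dual_cst0 is_dual_cst0.
under eq_fun do rewrite mulr0 addr0.
by rewrite mulN1r addNr.
Qed.

Lemma is_bidual_sum S (I : Type) (l : seq I) (c : I -> R[i])
    (h : I -> V -> R[i]) : is_bidual S -> (forall i, is_dual (h i)) ->
  S (fun v => \sum_(i <- l) c i * h i v) = \sum_(i <- l) c i * S (h i).
Proof.
move=> Sb hd; elim: l => [|i l IHl].
  by under eq_fun do rewrite big_nil; rewrite big_nil is_bidual0.
under eq_fun do rewrite big_cons.
by rewrite big_cons -IHl Sb.1//; exact: is_dual_sum.
Qed.

Lemma is_bidual_le S : is_bidual S -> exists2 M : R[i], 0 <= M &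
  forall f (c : R[i]), is_dual f -> 0 <= c -> (forall v, `|f v| <= c * `|v|) ->
    `|S f| <= M * c.
Proof.
move=> [_ [M SM]]; exists M => //.
(* Testing the bound on the zero functional with [c = 1] shows that [M] is nonnegative. *)
apply: le_trans (normr_ge0 (S (fun=> 0))) _; rewrite -[M]mulr1.
by apply: SM => // [|v]; [exact: is_dual_cst0|rewrite normr0 mul1r].
Qed.

(** Rotating and normalising [v] gives a vector of the ball at which [f] takes the real value
    [|f v| / |v|]. *)
Lemma is_dual_ball_bound f (b : R) : is_dual f ->
  (forall v, cball1 v -> Re (f v) <= b) ->
  0 <= b /\ forall v, `|f v| <= b%:C * `|v|.
Proof.
move=> fd fb; have f0 := is_dual0 _ _ fd.
have b0 : 0 <= b by have := fb 0; rewrite /cball1 /= f0 normr0; apply.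
split=> // v; have [->|v0] := eqVneq v 0; first by rewrite f0 !normr0 mulr0.
have fZ (c : R[i]) : f (c *: v) = c * f v.
  by have := fd.1 c v 0; rewrite f0 !addr0.
have [u u1 uf] := exists_rotation (f v).
rewrite -ler_pdivrMr ?normr_gt0//.
have fE : f ((`|v|^-1 * u) *: v) = `|f v| / `|v| by rewrite fZ -mulrA uf mulrC.
rewrite -fE -[f _]Re_ge0K; last by rewrite fE divr_ge0.
rewrite lecR; apply: fb.
rewrite /cball1 /= normrZ normrM u1 mulr1 normfV normr_id mulVf//.
by rewrite normr_eq0.
Qed.

Let sqn (z : R[i]) : R := Re z ^+ 2 + Im z ^+ 2.

Let sqn_ge0 z : 0 <= sqn z.
Proof. by rewrite addr_ge0// sqr_ge0. Qed.

Lemma is_dual_sqn_bounded (l : seq (dualT V)) : exists2 L : R, 0 <= L &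
  forall u v, cball1 u -> cball1 v ->
    \sum_(f <- l) (Re (sval f u - sval f v) ^+ 2 +
                   Im (sval f u - sval f v) ^+ 2) <= L.
Proof.
elim: l => [|f l [L L0 IHl]].
  by exists 0 => // u v _ _; rewrite big_nil.
have [c c0 fc] := is_dual_le _ _ (svalP f).
exists (Re ((2 * c) ^+ 2) + L) => [|u v u1 v1].
  by rewrite addr_ge0// -ler0c Re_ge0K exprn_ge0// mulr_ge0.
rewrite big_cons lerD ?IHl// -lecR add_Re2_Im2 Re_ge0K; last first.
  by rewrite exprn_ge0// mulr_ge0.
rewrite lerXn2r ?nnegrE ?mulr_ge0//.
rewrite -is_dualB; last exact: (svalP f).
rewrite (le_trans (fc _))// mulrC ler_wpM2r//.
by rewrite (le_trans (ler_normB _ _))// [leRHS](natrD _ 1 1) lerD.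
Qed.

(* Near-minimality of [a] among the ball for the quadratic distance to [S]
   makes the functional [g = \sum_f (S f - f a)^* f] almost maximal at [a],
   and [|S g|] is at most the supremum of [g] on the ball. *)
Theorem goldstine S (l : seq (dualT V)) (e : R) : is_bidual S ->
  (forall f (c : R[i]), is_dual f -> 0 <= c ->
     (forall v, `|f v| <= c * `|v|) -> `|S f| <= c) ->
  0 < e -> exists2 a : V, cball1 a &
    \sum_(f <- l) (Re (S (sval f) - sval f a) ^+ 2 +
                   Im (S (sval f) - sval f a) ^+ 2) <= e.
Proof.
move=> Sb S1 e0; have [L L0 HL] := is_dual_sqn_bounded l.
pose Q a := \sum_(f <- l) sqn (S (sval f) - sval f a).
have Q0 a : 0 <= Q a by apply: sumr_ge0 => f _; exact: sqn_ge0.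
have Le0 : 0 < L + e by lra.
(* The step length is small enough that the quadratic term, at most [t ^+ 2 * L], does not exceed
   [t * e]; also [t <= 1], so the moved point stays in the ball. *)
pose t := e / (L + e).
have t0 : 0 < t by rewrite divr_gt0.
have t1 : t <= 1 by rewrite ler_pdivrMr//; lra.
have tL : t * L <= e.
  rewrite /t mulrAC ler_pdivrMr// ler_wpM2l//; lra.
have [_ [a a1 <-] Qa] : exists2 q, (Q @` (@cball1 _ V)) q &
    q < inf (Q @` (@cball1 _ V)) + t * e.
  apply: inf_adherent; first exact: mulr_gt0.
  split; first by exists (Q 0), 0; rewrite // /cball1 /= normr0.
  by exists 0 => _ [? _ <-].
exists a => //; rewrite -[leLHS]/(Q a).
pose d (f : dualT V) := S (sval f) - sval f a.
pose g v := \sum_(f <- l) (d f)^* * sval f v.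
have gd : is_dual g by apply: is_dual_sum => f; exact: (svalP f).
have ReB (z w : R[i]) : Re (z - w) = Re z - Re w by case: z w => ? ? [].
(* On the segment from [a] to [v], [Q] is a quadratic polynomial whose linear coefficient is
   governed by [g]. *)
have Qt v : Q (t%:C *: (v - a) + a) = Q a - 2 * t * Re (g v - g a) +
    t ^+ 2 * \sum_(f <- l) sqn (sval f v - sval f a).
  have -> : Re (g v - g a) =
      \sum_(f <- l) Re ((d f)^* * (sval f v - sval f a)).
    rewrite -sumrB; elim/big_ind2: _ => // [x y z w xy zw|f _].
      by rewrite ReD xy zw.
    by rewrite mulrBr.
  rewrite !mulr_sumr -sumrB -big_split /=; apply: eq_bigr => f _.
  rewrite (svalP f).1 is_dualB; last exact: (svalP f).
  rewrite opprD addrCA -/(d f) addrC.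
  move: (d f) (sval f v - sval f a) => [x y] [z w]; rewrite /sqn /=; ring.
(* Moving towards [v] lowers [Q] by less than [t * e], so [2 * t * Re (g v - g a)] is at most
   [2 * t * e]. *)
have gle v : cball1 v -> Re (g v) <= Re (g a) + e.
  move=> v1; rewrite -lerBlDl -ReB -(ler_pM2l t0).
  have : inf (Q @` (@cball1 _ V)) <= Q (t%:C *: (v - a) + a).
    apply: ge_inf; first by exists 0 => _ [? _ <-].
    exists (t%:C *: (v - a) + a) => //.
    rewrite /cball1 /= scalerBr -addrA [- _ + _]addrC -[X in X - _]scale1r.
    rewrite -scalerBl (le_trans (ler_normD _ _))// !normrZ.
    rewrite !ger0_norm ?ler0c ?subr_ge0 -?(rmorph1 (real_complex R)) ?lecR//;
      last exact: ltW.
    rewrite -[leRHS](subrK t%:C) addrC -rmorphB /=; apply: lerD.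
      by rewrite ler_piMr// ler0c subr_ge0.
    by rewrite ler_piMr// ler0c ltW.
  rewrite Qt => Qle.
  have : t ^+ 2 * \sum_(f <- l) sqn (sval f v - sval f a) <= t * e.
    rewrite expr2 -mulrA ler_pM2l//; apply: le_trans tL.
    by rewrite ler_pM2l//; exact: HL.
  by lra.
have [b0 gb] := is_dual_ball_bound g _ gd gle.
have Sg : Re (S g) <= Re (g a) + e.
  apply: le_trans (Re_le_norm _) _; rewrite -lecR Re_ge0K//.
  by apply: S1 => //; rewrite ler0c.
(* Each summand of [S g - g a] is the conjugate of [d f] times [d f], that is, [sqn (d f)]. *)
have -> : Q a = Re (S g - g a); last by rewrite ReB; lra.
rewrite is_bidual_sum//; last by move=> f; exact: (svalP f).
rewrite -sumrB /Q; elim/big_ind2: _ => // [x y z w xy zw|f _].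
  by rewrite xy zw ReD.
rewrite -mulrBr -/(d f); case: (d f) => x y; rewrite /sqn /=; ring.
Qed.

End Bidual.

(** * Weakly compact operators *)

Lemma prod_topology_cvg (I : Type) (T : topologicalType)
    (F : set_system {ptws I -> T}) (f : {ptws I -> T}) : Filter F ->
  (forall i, (fun g : {ptws I -> T} => g i) @ F --> f i) -> F --> f.
Proof.
move=> FF Fi; rewrite cvg_sup => i.
(* Constant functions show that each coordinate projection is surjective. *)
rewrite cvg_image; last by rewrite eqEsubset; split=> v // _; exists (cst v).
move=> W /Fi FW; exists ((fun g : {ptws I -> T} => g i) @^-1` W) => //.
by rewrite eqEsubset; split=> [_ [g + <-]//|w Ww]; exists (fun=> w).
Qed.

Lemma prod_topology_proj (I : Type) (T : topologicalType) (i : I) :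
  continuous (fun g : {ptws I -> T} => g i).
Proof. exact: (@proj_continuous {classic I} (fun=> T) i). Qed.

Lemma prod_topology_hausdorff (I : Type) (T : topologicalType) :
  hausdorff_space T -> hausdorff_space {ptws I -> T}.
Proof. by move=> hT; apply: (@hausdorff_product {classic I} (fun=> T)). Qed.

Section WeakCompactness.
Context {R : realType}.

Local Notation K := (R[i] : numFieldType).

Lemma real_complex_continuous : continuous (fun x : R => x%:C : K).
Proof.
move=> x; apply/cvgrPdist_lt => e e0.
have Re0 : 0 < Re e by rewrite -ltcR Re_ge0K// ltW.
near=> y; rewrite -rmorphB normc_def /= expr0n addr0 sqrtr_sqr.
rewrite -[ltRHS]Re_ge0K ?ltW// ltcR.
by near: y; move/cvgrPdist_lt : (@cvg_id _ (nbhs x)); apply.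
Unshelve. all: by end_near. Qed.

Lemma complex_Re_continuous : continuous (fun z : K => Re z : R).
Proof.
move=> z; apply/(@cvgrPdist_lt _ _ _ (nbhs z) (nbhs_filter z)) => e e0.
have : nbhs z (ball z (e%:C : K)) by apply: nbhsx_ballx; rewrite ltcR.
apply: filterS => w; rewrite -ball_normE /= => zw; rewrite -ltcR.
have -> : Re z - Re w = Re (z - w) by case: z w {zw} => ? ? [].
exact: le_lt_trans (normc_ge_Re _) zw.
Qed.

Lemma closed_disc (c : R) : closed [set z : K | Re `|z| <= c].
Proof.
apply: (@closed_comp _ _ (fun z : K => Re `|z|) [set x | x <= c]).
  move=> z _; apply: continuous_comp; first exact: norm_continuous.
  exact: complex_Re_continuous.
exact: closed_le.
Qed.

(** The disc is a closed part of the image of the square [[-c, c] x [-c, c]] under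
    [(x, y) |-> x + i y]. *)
Lemma compact_disc (c : R) : compact [set z : K | Re `|z| <= c].
Proof.
have Cf : continuous (fun xy : R * R => xy.1%:C + 'i * xy.2%:C : K).
  move=> xy; apply: cvgD.
    by apply: (cvg_comp _ _ (@cvg_fst _ _ _ _ _));
      exact: real_complex_continuous.
  apply: cvgM; first exact: cvg_cst.
  by apply: (cvg_comp _ _ (@cvg_snd _ _ _ _ _));
    exact: real_complex_continuous.
have cS := compact_setX (@segment_compact _ (- c) c)
  (@segment_compact _ (- c) c).
apply: (subclosed_compact (closed_disc c)
  (continuous_compact (continuous_subspaceT Cf) cS)).
move=> z zc; exists (Re z, Im z); last by rewrite /= -complexE.
split; rewrite /= in_itv /= -ler_norml; apply: le_trans zc.
  by rewrite -lecR Re_ge0K// normc_ge_Re.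
have -> : Im z = - Re (z * 'i) by rewrite ReiNIm opprK.
rewrite normrN -lecR Re_ge0K// (le_trans (normc_ge_Re _))// normrM.
by rewrite [ `|'i|]normc_def /= expr0n expr1n add0r sqrtr1 mulr1.
Qed.

Context {V W : normedModType R[i]}.

Definition weak_embedding : weak_of W -> {ptws dualT W -> K} :=
  fun v f => sval f v.

Lemma weak_embedding_continuous : continuous weak_embedding.
Proof. exact: initial_continuous. Qed.

Lemma weak_embedding_inj : injective weak_embedding.
Proof.
move=> u v uv; apply: (@dual_separates _ W) => f fd.
exact: (congr1 (fun g => g (exist _ f fd)) uv).
Qed.

Lemma weak_hausdorff : hausdorff_space (weak_of W).
Proof.
move=> p q pq; apply: weak_embedding_inj.
apply: (prod_topology_hausdorff (dualT W) _ (@norm_hausdorff _ K)).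
move=> A B /weak_embedding_continuous pA /weak_embedding_continuous qB.
by have [x [Ax Bx]] := pq _ _ pA qB; exists (weak_embedding x).
Qed.

Lemma is_dual_comp (T : V -> W) (f : W -> R[i]) : bdd_linear T ->
  is_dual f -> is_dual (fun v => f (T v)).
Proof.
move=> [Tlin [M TM]] fd; have [c c0 fc] := is_dual_le _ _ fd.
split=> [k u v|]; first by rewrite Tlin fd.1.
exists (c * M) => v; rewrite (le_trans (fc _))// -mulrA.
exact: ler_wpM2l.
Qed.

(** This is the adjoint of [T]. *)
Definition pullback (T : V -> W) (bT : bdd_linear T) (f : dualT W) : dualT V :=
  exist _ (fun v => sval f (T v)) (is_dual_comp _ _ bT (svalP f)).

(** * Gantmacher's criterion for a bounded operator *)

Section FromWeaklyCompact.
Variable T : V -> W.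
Hypothesis bT : bdd_linear T.

(* By Goldstine's theorem, [f |-> S (f o T)] is a pointwise limit of points of
   [T (ball)], so it lies in the compact, hence closed, image of the weak
   closure of [T (ball)]. *)
Let contraction_represented S : weakly_compact T -> is_bidual S ->
  (forall f (c : R[i]), is_dual f -> 0 <= c ->
     (forall v, `|f v| <= c * `|v|) -> `|S f| <= c) ->
  exists y, forall f, is_dual f -> S (fun v => f (T v)) = f y.
Proof.
move=> cT Sb S1; pose C := @closure (weak_of W) (T @` (@cball1 _ V)).
pose s : {ptws dualT W -> K} := fun f => S (sval (pullback T bT f)).
pose base (le : seq (dualT W) * R) := [set a : V | cball1 a /\
  \sum_(f <- le.1) (Re (s f - sval f (T a)) ^+ 2 +
                    Im (s f - sval f (T a)) ^+ 2) <= le.2].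
pose G := filter_from [set le : seq (dualT W) * R | 0 < le.2] base.
have sq_ge0 (z : R[i]) : 0 <= Re z ^+ 2 + Im z ^+ 2.
  by rewrite addr_ge0// sqr_ge0.
(* Two base sets are refined by concatenating their lists and taking the smaller tolerance. *)
have FG : Filter G.
  apply: filter_from_filter; first by exists ([::], 1) => /=.
  move=> [l1 e1] [l2 e2] /= e10 e20; exists (l1 ++ l2, Num.min e1 e2).
    by rewrite /= lt_min e10.
  move=> a [/= a1]; rewrite big_cat le_min /= => /andP[le1 le2].
  by split; split=> //=; [apply: le_trans le1|apply: le_trans le2];
    rewrite ?lerDl ?lerDr; apply: sumr_ge0.
have cvgG : (weak_embedding \o T : V -> {ptws dualT W -> K}) @ G --> s.
  apply: prod_topology_cvg => f; apply/cvgrPdist_lt => e e0.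
  have Re0 : 0 < Re e by rewrite -ltcR Re_ge0K// ltW.
  (* The tolerance bounds a squared modulus; halving [Re e] gives a strict inequality. *)
  exists ([:: f], (Re e / 2) ^+ 2); first by rewrite /= exprn_gt0// divr_gt0.
  move=> a [_ /=]; rewrite big_cons big_nil addr0 => le.
  apply: (@le_lt_trans _ _ (Re e / 2)%:C); last first.
    by rewrite -[ltRHS]Re_ge0K ?ltW// ltcR; lra.
  rewrite -(@ler_pXn2r _ 2)// ?nnegrE ?ler0c ?divr_ge0 ?(ltW Re0)//.
  by rewrite -add_Re2_Im2 -rmorphXn lecR.
have cE : compact (weak_embedding @` C).
  apply: continuous_compact cT; apply: continuous_subspaceT.
  exact: weak_embedding_continuous.
have [y _ ys] : (weak_embedding @` C) s.
  apply: (compact_closed _ cE).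
    exact/prod_topology_hausdorff/norm_hausdorff.
  move=> B /cvgG [[l e] /= e0 leB].
  have [a a1 ale] := goldstine S [seq pullback T bT f | f <- l] e Sb S1 e0.
  rewrite big_map in ale.
  exists (weak_embedding (T a)); split; last by apply: leB; split.
  by exists (T a) => //; apply: subset_closure; exists a.
by exists y => f fd; rewrite -[LHS]/(s (exist _ f fd)) -ys.
Qed.

(** Scaling reduces to the contractive case. The factor is the inverse of [M + 1] since [M] may be
    zero. *)
Lemma weakly_compact_represented S : weakly_compact T -> is_bidual S ->
  exists y, forall f, is_dual f -> S (fun v => f (T v)) = f y.
Proof.
move=> cT Sb; have [M M0 SM] := is_bidual_le _ Sb.
have M1 : 0 < M + 1 by rewrite ltr_wpDl.
have [||y Sy] := @contraction_represented (fun f => (M + 1)^-1 * S f) cT.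
- split=> [c f g fd gd|]; first by rewrite Sb.1//; ring.
  exists ((M + 1)^-1 * M) => f c fd c0 fc.
  rewrite normrM ger0_norm ?invr_ge0 ?(ltW M1)// -mulrA ler_pM2l ?invr_gt0//.
  exact: SM.
- move=> f c fd c0 fc.
  rewrite normrM ger0_norm ?invr_ge0 ?(ltW M1)// ler_pdivrMl//.
  by rewrite (le_trans (SM _ _ fd c0 fc))// ler_wpM2r// lerDl.
exists ((M + 1) *: y) => f fd.
have -> : f ((M + 1) *: y) = (M + 1) * f y.
  by rewrite -[_ *: y]addr0 fd.1 (is_dual0 _ _ fd) addr0.
by rewrite -Sy// mulrA divff ?mul1r// gt_eqF.
Qed.

Let bounds (h : dualT V) : set R :=
  [set c | 0 <= c /\ forall v, `|sval h v| <= c%:C * `|v|].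

(** The disc whose radius is the operator norm of [h]. *)
Let values (h : dualT V) : set K :=
  \bigcap_(c in bounds h) [set z | Re `|z| <= c].

Let lin_relations : set (dualT V * dualT V * dualT V * K) :=
  [set x | sval x.1.2 = fun v => x.2 * sval x.1.1.1 v + sval x.1.1.2 v].

(** The unit ball of the bidual inside a product of discs. Linearity is imposed one relation
    [h = c f + g] at a time, each as the preimage of a disc of radius 0, so that every condition is
    visibly closed and Tychonoff's theorem applies. *)
Definition bidual_ball : set {ptws dualT V -> K} :=
  [set P | forall h, values h (P h)] `&`
  \bigcap_(x in lin_relations)
    [set P | Re `|P x.1.2 - (x.2 * P x.1.1.1 + P x.1.1.2)| <= 0].

Lemma compact_bidual_ball : compact bidual_ball.
Proof.
apply: compact_closedI.
  apply: (@tychonoff {classic dualT V} (fun=> K) values) => h.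
  have [c c0 hc] := is_dual_le _ _ (svalP h).
  apply: (subclosed_compact _ (compact_disc (Re c))).
    by apply: closed_bigI => d _; exact: closed_disc.
  by move=> z; apply; split=> [|v]; rewrite ?Re_ge0K// -ler0c Re_ge0K.
apply: closed_bigI => -[[[f g] h] c] _ /=.
apply: (@closed_comp _ _
  (fun P : {ptws dualT V -> K} => P h - (c * P f + P g)) _ _ (closed_disc 0)).
move=> P _.
have ev k : (fun P' : {ptws dualT V -> K} => P' k : K) @ nbhs P --> (P k : K).
  exact: prod_topology_proj.
exact: (cvgB (ev h) (cvgD (cvgM (cvg_cst c) (ev f)) (ev g))).
Qed.

(** Passes from functions on bundled functionals to the encoding of [is_bidual]; the value 0 off the
    dual is a placeholder. *)
Let extend (P : dualT V -> K) (f : V -> R[i]) : K :=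
  if pselect (is_dual f) is left fd then P (exist _ f fd) else 0.

Let extendE P (f : dualT V) : extend P (sval f) = P f.
Proof.
rewrite /extend; case: pselect => [fd|]; last by move/(_ (svalP f)).
by congr P; case: f fd => f fd fd'; congr exist; exact: Prop_irrelevance.
Qed.

Let extend_bidual P : bidual_ball P -> is_bidual (extend P).
Proof.
move=> [Pv Plin]; split=> [c f g fd gd|].
  pose f' : dualT V := exist _ f fd; pose g' : dualT V := exist _ g gd.
  pose h : dualT V := exist _ _ (is_dual_lin c _ _ fd gd).
  have : Re `|P h - (c * P f' + P g')| <= 0 := Plin (f', g', h, c) erefl.
  rewrite -lecR Re_ge0K// normr_le0 subr_eq0 => /eqP.
  by rewrite -!extendE.
exists 1 => f c fd c0 fc; rewrite mul1r (extendE P (exist _ f fd)).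
rewrite -[leRHS]Re_ge0K// -[leLHS]Re_ge0K// lecR; apply: Pv.
by split=> [|v]; rewrite ?Re_ge0K// -ler0c Re_ge0K.
Qed.

Let kappa_ball a : cball1 a -> bidual_ball (fun h => sval h a).
Proof.
move=> a1; split=> [h c [c0 hc]|[[[f g] h] c] /= hE].
  suff : Re `|sval h a| <= c by [].
  by rewrite -lecR Re_ge0K// (le_trans (hc a))// ler_piMr// ler0c.
suff : Re `|sval h a - (c * sval f a + sval g a)| <= 0 by [].
by rewrite hE subrr normr0.
Qed.

(* The unit ball of the bidual is compact (Banach-Alaoglu), and representing
   vectors map it continuously onto a weakly compact set that contains
   [T (ball)]. *)
Lemma represented_weakly_compact :
  (forall S, is_bidual S ->
     exists y, forall f, is_dual f -> S (fun v => f (T v)) = f y) ->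
  weakly_compact T.
Proof.
move=> repr; have /choice[Y YP] : forall P : {ptws dualT V -> K}, exists y : W,
    bidual_ball P -> forall f : dualT W, P (pullback T bT f) = sval f y.
  move=> P; have [Pb|] := pselect (bidual_ball P); last by exists 0.
  have [y Py] := repr _ (extend_bidual _ Pb); exists y => _ f.
  by rewrite -Py ?extendE//; [rewrite -extendE|exact: (svalP f)].
pose r (P : {ptws dualT V -> K}) : {ptws dualT W -> K} :=
  fun f => P (pullback T bT f).
have rc : continuous r.
  move=> P; apply: (@prod_topology_cvg _ _ (r @ nbhs P) (r P)) => f.
  exact: (prod_topology_proj _ _ (pullback T bT f) P).
(* The weak topology is initial for [weak_embedding], and on the ball [weak_embedding \o Y] agrees
   with the continuous map [r]. *)
have Yc : {within bidual_ball, continuous (Y : _ -> weak_of W)}.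
  apply: continuous_comp_initial.
  apply: subspace_eq_continuous (continuous_subspaceT rc).
  by move=> P /set_mem Pb; apply/funext => f; exact: YP.
have cY := continuous_compact Yc compact_bidual_ball.
apply: (subclosed_compact _ cY); first exact: closed_closure.
move=> y yT; apply: (compact_closed weak_hausdorff cY).
move: y yT; apply: closure_subset => _ [a a1 <-].
exists (fun h => sval h a); first exact: kappa_ball.
apply: (@dual_separates _ W) => f fd.
by have /= <- := YP _ (kappa_ball _ a1) (exist _ f fd).
Qed.

End FromWeaklyCompact.

End WeakCompactness.

(** * Arens products and representations *)

Section ArensProducts.
Context {R : realType} {A : normedModType R[i]}.
Variable mul : A -> A -> A.
Hypothesis mul_banach : banach_algebra_mul mul.
Variables S T : (A -> R[i]) -> R[i].
Hypotheses (Sb : is_bidual S) (Tb : is_bidual T).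
Implicit Types f g : A -> R[i].

Let mull_lin f (c : R[i]) a a' b : is_dual f ->
  f (mul (c *: a + a') b) = c * f (mul a b) + f (mul a' b).
Proof. by move=> fd; have [_ -> _ _] := mul_banach; rewrite fd.1. Qed.

Let mulr_lin f (c : R[i]) a b b' : is_dual f ->
  f (mul a (c *: b + b')) = c * f (mul a b) + f (mul a b').
Proof. by move=> fd; have [_ _ -> _] := mul_banach; rewrite fd.1. Qed.

Let mul_le f (c : R[i]) a b : 0 <= c -> (forall v, `|f v| <= c * `|v|) ->
  `|f (mul a b)| <= c * `|a| * `|b|.
Proof.
move=> c0 fc; rewrite (le_trans (fc _))// -mulrA ler_wpM2l//.
by have [_ _ _ ->] := mul_banach.
Qed.

Let mull_dual f a : is_dual f -> is_dual (fun b => f (mul a b)).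
Proof.
move=> fd; have [c c0 fc] := is_dual_le _ _ fd.
split=> [k u v|]; first exact: mulr_lin.
by exists (c * `|a|) => b; exact: mul_le.
Qed.

Let mulr_dual f b : is_dual f -> is_dual (fun a => f (mul a b)).
Proof.
move=> fd; have [c c0 fc] := is_dual_le _ _ fd.
split=> [k u v|]; first exact: mull_lin.
by exists (c * `|b|) => a; rewrite mulrAC; exact: mul_le.
Qed.

(** For [f] in the dual with bound [c], the inner function [a |-> T (b |-> f (a b))] is in the dual
    with bound [M * c], so linearity and boundedness of [S] apply to it. *)
Lemma arens_left_bidual : is_bidual (arens_left mul S T).
Proof.
have [M M0 TM] := is_bidual_le _ Tb; have [N N0 SN] := is_bidual_le _ Sb.
have Tlin f (k : R[i]) u v : is_dual f -> T (fun b => f (mul (k *: u + v) b)) =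
    k * T (fun b => f (mul u b)) + T (fun b => f (mul v b)).
  move=> fd; rewrite -Tb.1; [|exact: mull_dual..].
  by congr T; apply/funext => b; exact: mull_lin.
have Tle f (c : R[i]) a : is_dual f -> 0 <= c ->
    (forall v, `|f v| <= c * `|v|) ->
    `|T (fun b => f (mul a b))| <= M * c * `|a|.
  move=> fd c0 fc; rewrite -mulrA TM ?mulr_ge0//; first exact: mull_dual.
  by move=> b; exact: mul_le.
have Td f : is_dual f -> is_dual (fun a => T (fun b => f (mul a b))).
  move=> fd; have [c c0 fc] := is_dual_le _ _ fd.
  split=> [k u v|]; first exact: Tlin.
  by exists (M * c) => a; exact: Tle.
split=> [c f g fd gd|].
  rewrite /arens_left -Sb.1; [|exact: Td..].
  congr S; apply/funext => a; rewrite -Tb.1//; exact: mull_dual.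
exists (N * M) => f c fd c0 fc; rewrite -mulrA SN ?mulr_ge0//; first exact: Td.
by move=> a; exact: Tle.
Qed.

Lemma arens_right_bidual : is_bidual (arens_right mul S T).
Proof.
have [M M0 TM] := is_bidual_le _ Tb; have [N N0 SN] := is_bidual_le _ Sb.
have Slin f (k : R[i]) u v : is_dual f -> S (fun a => f (mul a (k *: u + v))) =
    k * S (fun a => f (mul a u)) + S (fun a => f (mul a v)).
  move=> fd; rewrite -Sb.1; [|exact: mulr_dual..].
  by congr S; apply/funext => a; exact: mulr_lin.
have Sle f (c : R[i]) b : is_dual f -> 0 <= c ->
    (forall v, `|f v| <= c * `|v|) ->
    `|S (fun a => f (mul a b))| <= N * c * `|b|.
  move=> fd c0 fc; rewrite -mulrA SN ?mulr_ge0//; first exact: mulr_dual.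
  by move=> a; rewrite mulrAC; exact: mul_le.
have Sd f : is_dual f -> is_dual (fun b => S (fun a => f (mul a b))).
  move=> fd; have [c c0 fc] := is_dual_le _ _ fd.
  split=> [k u v|]; first exact: Slin.
  by exists (N * c) => b; exact: Sle.
split=> [c f g fd gd|].
  rewrite /arens_right -Tb.1; [|exact: Sd..].
  congr T; apply/funext => b; rewrite -Sb.1//; exact: mulr_dual.
exists (M * N) => f c fd c0 fc; rewrite -mulrA TM ?mulr_ge0//; first exact: Sd.
by move=> b; exact: Sle.
Qed.

End ArensProducts.

Lemma kappa_bidual (R : realType) (V : normedModType R[i]) (v : V) :
  is_bidual (kappa v).
Proof.
split=> [//|]; exists `|v| => f c fd c0 fc.
by rewrite mulrC; exact: fc.
Qed.

(** * Orbit maps and the operators that represent [phitilde S] *)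

Section Representations.
Context {R : realType} {A X : normedModType R[i]}.
Variables (mul : A -> A -> A) (phi : A -> X -> X).
Hypothesis phi_rep : representation mul phi.

Lemma orbit_map_bdd_linear (x : X) : bdd_linear (fun a => phi a x).
Proof.
have [_ philin [M phiM] _] := phi_rep; split=> [c u v|]; first exact: philin.
by exists (M * `|x|) => a; rewrite mulrAC; exact: phiM.
Qed.

Lemma phitilde_bounded S : is_bidual S -> exists M : R[i],
  forall x (f : X -> R[i]), (forall v, `|f v| <= `|v|) -> is_dual f ->
    `|phitilde phi S x f| <= M * `|x|.
Proof.
move=> Sb; have [N N0 SN] := is_bidual_le _ Sb.
have [_ _ [M phiM] _] := phi_rep.
exists (N * `|M|) => x f f1 fd; rewrite -mulrA; apply: SN.
- exact: is_dual_comp (orbit_map_bdd_linear x) fd.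
- exact: mulr_ge0.
- move=> a; rewrite (le_trans (f1 _))// -mulrA; apply: le_normM_abs => //.
  by rewrite [`|x| * _]mulrC mulrA.
Qed.

(** Linearity is tested against the dual; a norming functional of [T x] turns the bound on
    [phitilde] into one on the norm of [T x]. *)
Lemma phitilde_represented S (T : X -> X) : is_bidual S ->
  (forall x f, is_dual f -> phitilde phi S x f = kappa (T x) f) ->
  bdd_linear T.
Proof.
move=> Sb ST; split=> [c u v|].
  apply: dual_separates => f fd; rewrite fd.1 -![f (T _)]ST//.
  rewrite -Sb.1; [|exact: (is_dual_comp _ _ (orbit_map_bdd_linear _) fd)..].
  congr S; apply/funext => a; have [philin _ _ _] := phi_rep.
  by rewrite (philin a).1 fd.1.
have [M SM] := phitilde_bounded S Sb; exists M => x.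
have [f [fd f1 fTx]] := dual_norming _ (T x).
apply: (le_trans fTx); rewrite -[f (T x)](ST x f fd); exact: SM.
Qed.

End Representations.

Theorem theorem2p5 (R : realType)
  (A X : completeNormedModType R[i]) (mul : A -> A -> A) (phi : A -> X -> X) :
  banach_algebra_mul mul ->
  representation mul phi ->
  ((forall S : (A -> R[i]) -> R[i], is_bidual S ->
      exists T : X -> X, bdd_linear T /\
        forall (x : X) (f : X -> R[i]), is_dual f ->
          phitilde phi S x f = kappa (T x) f)
   <-> (forall x : X, weakly_compact (fun a : A => phi a x)))
  /\
  ((forall x : X, weakly_compact (fun a : A => phi a x)) ->
   forall psi : ((A -> R[i]) -> R[i]) -> X -> X,
     (forall S, is_bidual S ->
        bdd_linear (psi S) /\
        forall (x : X) (f : X -> R[i]), is_dual f ->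
          phitilde phi S x f = kappa (psi S x) f) ->
     [/\ essential_space (@is_bidual _ A) psi = essential_space [set: A] phi,
         (forall S T, is_bidual S -> is_bidual T ->
            forall x, psi (arens_left mul S T) x = psi S (psi T x)),
         (forall S T, is_bidual S -> is_bidual T ->
            forall x, psi (arens_right mul S T) x = psi S (psi T x))
       & (forall a x, psi (kappa a) x = phi a x)]).

Proof.
move=> mul_banach phi_rep; have orbit := orbit_map_bdd_linear _ _ phi_rep.
have [philin _ _ phiM] := phi_rep; split.
  split=> [repr x|wc S Sb].
    apply: (represented_weakly_compact _ (orbit x)) => S Sb.
    by have [T [_ ST]] := repr S Sb; exists (T x) => f /(ST x).
  have /choice[T ST] x :=
    weakly_compact_represented _ (orbit x) S (wc x) Sb.
  exists T; split; last by [].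
  exact: (phitilde_represented _ _ phi_rep S).
move=> _ psi psiP.
have psiE S x f : is_bidual S -> is_dual f ->
    f (psi S x) = S (fun a => f (phi a x)).
  by move=> Sb fd; rewrite [RHS](psiP S Sb).2.
have psik a x : psi (kappa a) x = phi a x.
  by apply: dual_separates => f fd; rewrite psiE//; exact: kappa_bidual.
split=> // [|S T Sb Tb x|S T Sb Tb x].
(* It suffices that a closed subspace [M] containing one set of generators contains the other. For
   the generators [psi S y], a functional vanishing on [M] makes the argument of [S] zero. *)
- apply/seteqP; split=> x ex M [Mc Mlin MS]; apply: ex; split=> //.
    move=> _ [S Sb [y _ <-]].
    apply: (@dual_separates_closed_subspace R X M (psi S y) Mc Mlin) => f fd fM.
    rewrite psiE// -[RHS](is_bidual0 S Sb); congr S; apply/funext => a.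
    by apply: fM; apply: MS; exists a => //; exists y.
  move=> _ [a _ [y _ <-]]; apply: MS.
  exists (kappa a); first exact: kappa_bidual.
  by exists y => //; rewrite psik.
- apply: dual_separates => f fd; rewrite !psiE//; last exact: arens_left_bidual.
  congr S; apply/funext => a.
  (* For fixed [a], [T] is evaluated through the bounded functional [f \o phi a]. *)
  rewrite (psiE T x (fun y => f (phi a y)))//; last exact: is_dual_comp.
  by congr T; apply/funext => b; rewrite phiM.
- apply: dual_separates => f fd; rewrite psiE//; last exact: arens_right_bidual.
  (* Here [T] is outermost, so it is evaluated through [f \o psi S], which lies in the dual because
     [psi S] is bounded. *)
  rewrite (psiE T x (fun y => f (psi S y)))//; last first.
    exact: is_dual_comp (psiP S Sb).1 fd.
  congr T; apply/funext => b; rewrite psiE//.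
  by congr S; apply/funext => a; rewrite phiM.
Qed.
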